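(* Let $B_1, B_2 \subseteq \mathbb{R}^3$ be $2$-dimensional symmetric convex bodies and let $v^1, v^2 \in \mathbb{R}^3$ be arbitrary vectors such that $C_i = \operatorname{conv}(B_i \cup \{v^i\})$ is a $3$-dimensional convex body for $i=1, 2$. Then \[ d_{BM}(C_1, C_2) = d_{BM}(B_1, B_2). \]
   Context: A convex body in $\mathbb{R}^N$ is a compact convex set with non-empty interior; a $d$-dimensional convex body in $\mathbb{R}^N$ is a compact convex set whose affine span has dimension $d$. A set $A$ is (centrally) symmetric if some translate $A' = A+v$ satisfies $-A' = A'$. For convex bodies $K, L \subseteq \mathbb{R}^N$ (with non-empty interior), their Banach--Mazur distance is \[ d_{BM}(K,L) = \inf\{\rho \geq 0 : K+u \subseteq T(L+v) \subseteq \rho(K+u)\}, \] the infimum over all invertible linear operators $T: \mathbb{R}^N \to \mathbb{R}^N$ and vectors $u, v \in \mathbb{R}^N$. For $d$-dimensional convex bodies $K, L$ the distance is defined in this way after identifying their affine spans with $\mathbb{R}^d$ by affine isomorphisms. $\operatorname{conv}$ denotes the convex hull. *)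

(* Defs.v *)
From HB Require Import structures.
From mathcomp Require Import all_boot all_order all_algebra.
From mathcomp Require Import all_classical all_reals all_analysis.

Set Implicit Arguments.
Unset Strict Implicit.
Unset Printing Implicit Defensive.

Import Order.TTheory GRing.Theory Num.Theory.
Import numFieldNormedType.Exports.

Local Open Scope classical_set_scope.
Local Open Scope ring_scope.

Section Convexity.
Context {R : realType} {N : nat}.
Implicit Types A K : set 'rV[R]_N.

Definition convex_hull A : set 'rV[R]_N :=
  smallest (fun B : set 'rV[R]_N => convex_set B) A.

Definition affine_set A : Prop :=
  forall x y t, A x -> A y -> A (t *: x + (1 - t) *: y).

Definition affine_span A : set 'rV[R]_N := smallest affine_set A.

Definition has_affine_dim (d : nat) A : Prop :=
  exists (p : 'rV[R]_N) (V : {vspace 'rV[R]_N}),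
    \dim V = d /\ affine_span A = [set p + w | w in [set` V]].

(* A convex body with non-empty interior is the case [d = N]. *)
Definition convex_body (d : nat) K : Prop :=
  [/\ compact K, convex_set K & has_affine_dim d K].

Definition translate A (u : 'rV[R]_N) : set 'rV[R]_N := [set x + u | x in A].

Definition centrally_symmetric A : Prop :=
  exists v, [set - x | x in translate A v] = translate A v.

End Convexity.

Section BanachMazur.
Context {R : realType}.

Definition BM_ratio (n : nat) (K L : set 'rV[R]_n) (rho : R) : Prop :=
  0 <= rho /\
  exists (T : {linear 'rV[R]_n -> 'rV[R]_n}) (u v : 'rV[R]_n),
    [/\ bijective T,
        translate K u `<=` T @` translate L v &
        T @` translate L v `<=` [set rho *: x | x in translate K u]].

(* The infimum is taken in the extended reals, so that it is meaningful even
   where no ratio exists. *)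
Definition dBM (n : nat) (K L : set 'rV[R]_n) : \bar R :=
  ereal_inf [set rho%:E | rho in BM_ratio K L].

Definition affine_iso (d N : nat) (E : set 'rV[R]_N)
    (f : 'rV[R]_d -> 'rV[R]_N) : Prop :=
  exists (p : 'rV[R]_N) (T : {linear 'rV[R]_d -> 'rV[R]_N}),
    [/\ injective T, forall x, f x = p + T x & range f = E].

(* An arbitrarily chosen affine isomorphism from R^d onto the affine span;
   [dBM_dimE] shows that the choice does not affect [dBM_dim]. *)
Definition chart (d N : nat) (K : set 'rV[R]_N) : 'rV[R]_d -> 'rV[R]_N :=
  xget (fun=> 0) (affine_iso (affine_span K)).
Arguments chart : clear implicits.

Definition dBM_dim (d N : nat) (K L : set 'rV[R]_N) : \bar R :=
  dBM (chart d N K @^-1` K) (chart d N L @^-1` L).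

Lemma affine_iso_exists (d N : nat) (K : set 'rV[R]_N) :
  has_affine_dim d K ->
  exists f : 'rV[R]_d -> 'rV[R]_N, affine_iso (affine_span K) f.
Proof.
move=> [p [V [dV ->]]]; subst d.
pose T (x : 'rV[R]_(\dim V)) := \sum_i x ord0 i *: (vbasis V)`_i.
have Tlin : linear T.
  move=> a x y; rewrite /T scaler_sumr -big_split; apply: eq_bigr => i _ /=.
  by rewrite !mxE scalerDl scalerA.
pose Tm := GRing.isLinear.Build _ _ _ _ T Tlin.
pose TL : {linear 'rV[R]_(\dim V) -> 'rV[R]_N} := HB.pack T Tm.
have coordT x i : coord (vbasis V) i (T x) = x ord0 i.
  by apply: coord_sum_free; exact: basis_free (vbasisP V).
exists (fun x => p + TL x); exists p, TL; split => //.
  move=> x y /= xy; apply/rowP => i.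
  by rewrite -!coordT; congr (coord _ _ _).
apply/seteqP; split => [_ [x _ <-]|_ [w /= wV <-]].
  exists (TL x) => //=; apply: memv_suml => i _; apply: memvZ.
  by apply: vbasis_mem; rewrite mem_nth // size_tuple.
exists (\row_i coord (vbasis V) i w) => //=; congr (p + _).
rewrite [RHS](coord_vbasis wV) /T; apply: eq_bigr => i _.
by rewrite mxE.
Qed.

Lemma affine_iso_change (d N : nat) (E : set 'rV[R]_N)
    (f g : 'rV[R]_d -> 'rV[R]_N) :
  affine_iso E f -> affine_iso E g ->
  exists (S : {linear 'rV[R]_d -> 'rV[R]_d}) (c : 'rV[R]_d),
    bijective S /\ forall x, g x = f (S x + c).
Proof.
have half (E' : set 'rV[R]_N) f1 g1 (p1 q1 : 'rV[R]_N)
    (T U : {linear 'rV[R]_d -> 'rV[R]_N}) :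
  injective T -> (forall x, f1 x = p1 + T x) -> range f1 = E' ->
  (forall x, g1 x = q1 + U x) -> range g1 = E' ->
  let h := ((linfun T)^-1)%VF in
  [/\ cancel T h, forall x, T (h (U x)) = U x & T (h (q1 - p1)) = q1 - p1].
  move=> Tinj fE fr gE gr h.
  have k0 : lker (linfun T) == 0%VS.
    by apply/lker0P => x y; rewrite !lfunE; exact: Tinj.
  have TK : cancel T h by move=> x; rewrite -(lfunE T x) /h lker0_lfunK.
  have im x : exists y, q1 + U x = p1 + T y.
    have : E' (g1 x) by rewrite -gr; exists x.
    by rewrite -fr => -[y _]; rewrite fE gE => <-; exists y.
  have [y0 y0E] := im 0.
  have q0 : q1 - p1 = T y0.
    by move: y0E; rewrite linear0 addr0 => ->; rewrite addrC addKr.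
  split=> // [x|]; last by rewrite q0 TK.
  have [y yE] := im x.
  suff -> : U x = T (y - y0) by rewrite TK.
  rewrite linearB -q0; apply: (addrI q1); rewrite yE.
  by rewrite opprB addrCA [q1 + _]addrC subrK addrC.
move=> [p [T [Tinj fE fr]]] [q [U [Uinj gE gr]]].
have [TK TU Tq] := half _ _ _ _ _ _ _ Tinj fE fr gE gr.
have [UK UT _] := half _ _ _ _ _ _ _ Uinj gE gr fE fr.
set hT := ((linfun T)^-1)%VF in TK TU Tq.
set hU := ((linfun U)^-1)%VF in UK UT.
exists (hT \o U), (hT (q - p)); split.
  by exists (hU \o T) => x /=; [rewrite TU UK | rewrite UT TK].
move=> x; rewrite gE fE linearD /= TU Tq.
by rewrite addrCA [p + _]addrC subrK addrC.
Qed.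

Lemma BM_ratio_affine (n : nat) (K L : set 'rV[R]_n)
    (S S' : {linear 'rV[R]_n -> 'rV[R]_n}) (c c' : 'rV[R]_n) (rho : R) :
  bijective S -> bijective S' -> BM_ratio K L rho ->
  BM_ratio [set x | K (S x + c)] [set x | L (S' x + c')] rho.
Proof.
move=> Sb [S'i S'K S'iK] [rho0 [T [u [v [Tb KT TK]]]]].
have [Si SK SiK] := Sb.
have kS : lker (linfun S) == 0%VS.
  by apply/lker0P => x y; rewrite !lfunE => /(can_inj SK).
pose h := ((linfun S)^-1)%VF.
have hE x : h x = Si x by rewrite -{1}(SiK x) -(lfunE S) /h lker0_lfunK.
have hS x : h (S x) = x by rewrite hE SK.
have Sh x : S (h x) = x by rewrite hE SiK.
have trE (A : set 'rV[R]_n) (F : {linear 'rV[R]_n -> 'rV[R]_n}) Fi a w y :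
    cancel F Fi -> cancel Fi F ->
    translate [set x | A (F x + a)] (Fi (a + w)) y <-> translate A w (F y).
  move=> FK FiK; split=> [[x Ax <-]|[x Ax xE]].
    by exists (F x + a) => //; rewrite linearD FiK addrA.
  exists (y - Fi (a + w)); last by rewrite subrK.
  rewrite /= linearB FiK -xE.
  have -> : x + w - (a + w) + a = x by rewrite opprD addrACA subrr addr0 subrK.
  by [].
split=> //.
exists (h \o (T \o S')), (h (c + u)), (S'i (c' + v)); split.
- apply: bij_comp; first by exists S.
  by apply: bij_comp => //; exists S'i.
- move=> y /(trE K S h c u y hS Sh) /KT [z Lz zE].
  exists (S'i z); last by rewrite /= S'iK zE hS.
  by apply/(trE L S' S'i c' v _ S'K S'iK); rewrite S'iK.
- move=> _ [y /(trE L S' S'i c' v y S'K S'iK) Ly <-].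
  have [|z Kz zE] := TK (T (S' y)); first by exists (S' y).
  exists (h z); last by rewrite /= -zE linearZ.
  by apply/(trE K S h c u _ hS Sh); rewrite Sh.
Qed.

Lemma dBM_affine_iso (d N : nat) (E F K L : set 'rV[R]_N)
    (f f' g g' : 'rV[R]_d -> 'rV[R]_N) :
  affine_iso E f -> affine_iso E f' -> affine_iso F g -> affine_iso F g' ->
  dBM (f @^-1` K) (g @^-1` L) = dBM (f' @^-1` K) (g' @^-1` L).
Proof.
have sub (h h' k k' : 'rV[R]_d -> 'rV[R]_N) :
    affine_iso E h -> affine_iso E h' ->
    affine_iso F k -> affine_iso F k' ->
    BM_ratio (h @^-1` K) (k @^-1` L) `<=` BM_ratio (h' @^-1` K) (k' @^-1` L).
  move=> Eh Eh' Fk Fk' rho hk.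
  have [S [c [Sb hE]]] := affine_iso_change Eh Eh'.
  have [S' [c' [S'b kE]]] := affine_iso_change Fk Fk'.
  rewrite (_ : h' @^-1` K = [set x | (h @^-1` K) (S x + c)]); last first.
    by apply/seteqP; split=> x /=; rewrite hE.
  rewrite (_ : k' @^-1` L = [set x | (k @^-1` L) (S' x + c')]); last first.
    by apply/seteqP; split=> x /=; rewrite kE.
  exact: BM_ratio_affine.
move=> Ef Ef' Fg Fg'; rewrite /dBM; congr (ereal_inf (_ @` _)).
by apply/seteqP; split; exact: sub.
Qed.

Lemma dBM_dimE (d N : nat) (K L : set 'rV[R]_N)
    (f g : 'rV[R]_d -> 'rV[R]_N) :
  affine_iso (affine_span K) f -> affine_iso (affine_span L) g ->
  dBM_dim d K L = dBM (f @^-1` K) (g @^-1` L).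
Proof.
move=> Kf Lg.
apply: (@dBM_affine_iso _ _ (affine_span K) (affine_span L)) => //.
  exact: (xgetPex (fun=> 0) (ex_intro _ f Kf)).
exact: (xgetPex (fun=> 0) (ex_intro _ g Lg)).
Qed.

End BanachMazur.

(* Main.v *)
Require Import Defs.
From HB Require Import structures.
From mathcomp Require Import all_boot all_order all_algebra.
From mathcomp Require Import all_classical all_reals all_analysis.
From mathcomp Require Import ring lra.

Set Implicit Arguments.
Unset Strict Implicit.
Unset Printing Implicit Defensive.

Import Order.TTheory GRing.Theory Num.Theory.
Import numFieldNormedType.Exports.

Local Open Scope classical_set_scope.
Local Open Scope ring_scope.

(* Up to affine maps, [C_i] is the cone [{(x, t) | x \in (1 - t) K_i}] over a
   planar body [K_i] symmetric about 0.  Maps nesting [K_1] and [K_2] with ratio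
   [rho] extend to the cones, placing the origin at the centre of the base.

   Conversely let [P <= Q <= rho P + w], where [P] is an affine copy of the
   first cone and [Q] the second cone.  Write [v] for the apex and [c] for the centre
   of the base of [P], and [t] for the height in [Q].
   - If some segment from [v] to the base of [P] is parallel to a segment from
     the apex to the base of [Q], projecting along it maps both cones onto
     their bases, and [rho] is a ratio for [K_1] and [K_2].
   - Otherwise [rho >= 2].  Let [f] be a functional with maximum 1 on [K_2]. The
     functionals [1 - t + f], [1 - t - f] and [2 t] are nonnegative on [Q] and
     add up to 2, and each must have on [P] an oscillation at least [2 / rho].
     If the height of [2 c - v] lies between 0 and 1, take [f] zero at [2 c - v]:
     by symmetry of the base, no functional exceeds on [P] twice its value at
     [c].  If that height is negative, [v] is the top of [P] and an [f]
     separating the two cones of directions makes two of the functionals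
     maximal at [v].  If it exceeds 1, then [c] has height more than 1/2, and
     [P] is too thin in the direction of an [f] with [f v = f c].
   Since [d(K_1, K_2) <= 2] for planar symmetric bodies, both cases suffice. *)

(** * Convex sets, linear functionals and separation *)

Section Convex.
Context {R : realType} {n : nat}.
Implicit Types (K W : set 'rV[R]_n) (f w x y : 'rV[R]_n) (a b c : R).

Lemma convex_setP K : convex_set K <->
  forall x y a b, 0 <= a -> 0 <= b -> a + b = 1 -> K x -> K y ->
  K (a *: x + b *: y).
Proof.
split=> [cK x y a b a0 b0 ab Kx Ky|cK x y l /set_mem Kx /set_mem Ky].
  have a1 : a <= 1 by lra.
  have := cK x y (Itv01 a0 a1) (mem_set Kx) (mem_set Ky).
  by rewrite inE (_ : b = 1 - a) //; lra.
apply/mem_set; apply: cK => //; first by rewrite subr_ge0.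
exact: subrKC.
Qed.

Definition dot f x : R := \sum_i f 0 i * x 0 i.

Lemma dotD f x y : dot f (x + y) = dot f x + dot f y.
Proof.
by rewrite /dot -big_split; apply: eq_bigr => i _; rewrite !mxE mulrDr.
Qed.

Lemma dotZ f a x : dot f (a *: x) = a * dot f x.
Proof.
by rewrite /dot mulr_sumr; apply: eq_bigr => i _; rewrite !mxE mulrCA.
Qed.

Lemma dotN f x : dot f (- x) = - dot f x.
Proof. by rewrite -scaleN1r dotZ mulN1r. Qed.

Lemma dotB f x y : dot f (x - y) = dot f x - dot f y.
Proof. by rewrite dotD dotN. Qed.

Lemma dot0 f : dot f 0 = 0.
Proof. by rewrite -(scale0r 0) dotZ mul0r. Qed.

Lemma dotC f x : dot f x = dot x f.
Proof. by apply: eq_bigr => i _; rewrite mulrC. Qed.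

Lemma dotZl f a x : dot (a *: f) x = a * dot f x.
Proof. by rewrite !(dotC _ x) dotZ. Qed.

Lemma dot_delta f i : dot f (delta_mx 0 i) = f 0 i.
Proof.
rewrite /dot (bigD1 i) //= mxE !eqxx mulr1 big1 ?addr0 // => j ji.
by rewrite mxE (negbTE ji) andbF mulr0.
Qed.

Lemma dot_gt0 x : x != 0 -> 0 < dot x x.
Proof.
move=> x0; rewrite lt_def sumr_ge0 ?andbT => [|i _]; last first.
  by rewrite -expr2 sqr_ge0.
apply: contra x0; rewrite psumr_eq0 => [/allP h|i _]; last first.
  by rewrite -expr2 sqr_ge0.
apply/eqP/rowP => i; rewrite mxE.
by have := h i (mem_index_enum _); rewrite mulf_eq0 orbb => /eqP.
Qed.

Lemma dot_continuous f : continuous (dot f).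
Proof.
apply: continuous_big => [|i _]; first exact: add_continuous.
move=> x; apply: continuousM; first exact: cst_continuous.
exact: coord_continuous.
Qed.

Lemma linear_rV_continuous (m : nat) (T : {linear 'rV[R]_n -> 'rV[R]_m}) :
  continuous T.
Proof.
have -> : (T : _ -> _) = fun x => \sum_i x 0 i *: T (delta_mx 0 i).
  by apply/funext => x; rewrite {1}(row_sum_delta x) linear_sum;
     apply: eq_bigr => i _; rewrite linearZ.
apply: continuous_big => [|i _]; first exact: add_continuous.
by move=> x; apply: continuousZr_tmp; exact: coord_continuous.
Qed.

Lemma continuous_rVD (T : topologicalType) (f g : T -> 'rV[R]_n) :
  continuous f -> continuous g -> continuous (fun z => f z + g z).
Proof. by move=> cf cg z; apply: cvgD; [exact: cf|exact: cg]. Qed.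

Lemma continuous_rVZ (T : topologicalType) (k : T -> R) (f : T -> 'rV[R]_n) :
  continuous k -> continuous f -> continuous (fun z => k z *: f z).
Proof. by move=> ck cf z; apply: cvgZ; [exact: ck|exact: cf]. Qed.

Lemma add_cst_continuous w : continuous (fun x : 'rV[R]_n => x + w).
Proof.
apply: (@continuous_rVD _ idfun (fun=> w)); last exact: cst_continuous.
by move=> x P.
Qed.

(* The functional is the point of [W] closest to the origin. *)
Lemma separation0 W : W !=set0 -> compact W -> convex_set W -> ~ W 0 ->
  exists f, forall w, W w -> 0 < dot f w.
Proof.
move=> W0 cW /convex_setP convW nW0.
have cdd : continuous (fun x : 'rV[R]_n => dot x x).
  apply: continuous_big => [|i _]; first exact: add_continuous.
  by move=> x; apply: continuousM; exact: coord_continuous.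
have [f /set_mem Wf fmin] :=
  compact_EVT_min W0 cW (continuous_subspaceT cdd).
have f0 : 0 < dot f f.
  by apply: dot_gt0; apply/eqP => f0; apply: nW0; rewrite -f0.
exists f => w Ww; apply: (lt_le_trans f0); rewrite leNgt; apply/negP => fw.
pose d := dot f f - dot f w; pose q := dot (w - f) (w - f).
have d0 : 0 < d by rewrite subr_gt0.
have q0 : 0 <= q by apply: sumr_ge0 => i _; rewrite -expr2 sqr_ge0.
(* Moving from [f] towards [w] by a fraction [e] changes the squared norm by [e * (e * q - 2 * d)].
   This [e] is at most 1 and gives [e * q < d], so the norm would drop below its minimum. *)
pose e := d / (d + q).
have dq : 0 < d + q by lra.
have e0 : 0 < e by rewrite divr_gt0.
have e1 : e <= 1 by rewrite ler_pdivrMr // mul1r lerDl.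
have We : W ((1 - e) *: f + e *: w) by apply: convW => //; lra.
have := fmin _ (mem_set We).
have -> : (1 - e) *: f + e *: w = f + e *: (w - f).
  by rewrite scalerBl scale1r scalerBr addrAC addrA.
rewrite !dotD 2!(dotC (f + _)) !dotD !dotZ -/q.
rewrite (dotC (_ *: _) f) (dotC (e *: _) (w - f)) dotZ -/q !dotZ dotB.
rewrite -/q => h.
have : 0 <= e * (e * q - 2 * d) by rewrite /d; lra.
rewrite pmulr_rge0 //.
have -> : e * q = d - e * d by rewrite /e; field; lra.
nra.
Qed.

End Convex.

(** * Symmetric bodies and their norming functionals *)

Section SymBody.
Context {R : realType} {n : nat}.
Implicit Types (K : set 'rV[R]_n) (f w x y : 'rV[R]_n) (a b c : R).

(** Containing the coordinate vectors stands in for non-empty interior; it is arranged by choosing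
    the axes of the chart along points of the body. *)
Definition sym_body K := [/\ compact K, convex_set K, forall x, K x -> K (- x)
  & forall i, K (delta_mx 0 i)].

(** Signs are absorbed by the symmetry, and the missing weight is put on 0. *)
Lemma sym_body_comb K x y a b :
  sym_body K -> K x -> K y -> `|a| + `|b| <= 1 -> K (a *: x + b *: y).
Proof.
move=> [_ /convex_setP cK sK _] Kx Ky ab.
have sgK c z : K z -> exists2 z', K z' & c *: z = `|c| *: z'.
  move=> Kz; have [c0|c0] := leP 0 c; first by exists z; rewrite ?ger0_norm.
  by exists (- z); [exact: sK|rewrite ltr0_norm // scalerN scaleNr opprK].
have [x' Kx' ->] := sgK a x Kx; have [y' Ky' ->] := sgK b y Ky.
have a0 := normr_ge0 a; have b0 := normr_ge0 b.
set p := `|a| in ab a0 *; set q := `|b| in ab b0 *.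
have K0 : K 0.
  have := cK x (- x) 2^-1 2^-1; rewrite scalerN subrr.
  by apply=> //; first [lra|exact: sK].
have [s0|s0] := eqVneq (p + q) 0.
  have -> : p = 0 by lra.
  have -> : q = 0 by lra.
  by rewrite !scale0r addr0.
have spos : 0 < p + q by lra.
have -> : p *: x' + q *: y' =
    (p + q) *: ((p / (p + q)) *: x' + (q / (p + q)) *: y') + (1 - (p + q)) *: 0.
  by rewrite scaler0 addr0 scalerDr !scalerA !mulrA ![(p + q) * _]mulrC !mulfK.
apply: (cK) => //; try lra.
apply: cK => //; first by rewrite divr_ge0 // ltW.
  by rewrite divr_ge0 // ltW.
by field.
Qed.

Lemma sym_body_scale K x a : sym_body K -> K x -> `|a| <= 1 -> K (a *: x).
Proof.
move=> bK Kx a1; rewrite -[_ *: x]addr0 -(scale0r x).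
by apply: sym_body_comb => //; rewrite normr0 addr0.
Qed.

Lemma sym_body_norming K f : sym_body K -> f != 0 ->
  exists c y0, [/\ 0 < c, K y0, dot f y0 = c &
    forall y, K y -> `|dot f y| <= c].
Proof.
move=> [cK _ sK eK] f0.
have [i fi] : exists i, f 0 i != 0.
  apply/existsP; apply: contraNT f0; rewrite negb_exists => /forallP h.
  by apply/eqP/rowP => i; rewrite mxE; apply/eqP; have := h i; rewrite negbK.
have K0 : K !=set0 by exists (delta_mx 0 i).
have [y0 /set_mem Ky0 ymax] :=
  compact_EVT_max K0 cK (continuous_subspaceT (@dot_continuous _ _ f)).
have le y : K y -> `|dot f y| <= dot f y0.
  move=> Ky; rewrite ler_norml lerNl -dotN.
  by rewrite !ymax //; apply/mem_set => //; exact: sK.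
exists (dot f y0), y0; split => //.
by apply: lt_le_trans (le _ (eK i)); rewrite dot_delta normr_gt0.
Qed.

Lemma sym_body_normed K f : sym_body K -> f != 0 ->
  exists c y0, [/\ 0 < c, K y0, dot (c *: f) y0 = 1 &
    forall y, K y -> `|dot (c *: f) y| <= 1].
Proof.
move=> bK f0; have [c [y0 [c0 Ky0 fy0 fy]]] := sym_body_norming bK f0.
exists c^-1, y0; split=> //; first by rewrite invr_gt0.
  by rewrite dotZl fy0 mulVf // gt_eqF.
move=> y Ky; rewrite dotZl normrM gtr0_norm ?invr_gt0 //.
by rewrite ler_pdivrMl // mulr1 fy.
Qed.

End SymBody.

(** * Planar symmetric bodies: any two are nested with ratio 2 *)

Section PlanarBodies.
Context {R : realType}.
Implicit Types (K L : set 'rV[R]_2) (f x y : 'rV[R]_2).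

(* [BM_ratio] without translations, which symmetry makes superfluous. *)
Definition nested K L (rho : R) := exists M : {linear 'rV[R]_2 -> 'rV[R]_2},
  (forall k, K k -> L (M k)) /\
  (forall y, L y -> exists2 k, K k & y = rho *: M k).

Lemma dot2E (f x : 'rV[R]_2) : dot f x = f 0 0 * x 0 0 + f 0 1 * x 0 1.
Proof.
rewrite /dot big_ord_recl big_ord1.
by congr (_ + f _ _ * x _ _); apply/val_inj.
Qed.

Lemma row2E x : x = x 0 0 *: delta_mx 0 0 + x 0 1 *: delta_mx 0 1.
Proof.
by rewrite {1}(row_sum_delta x) big_ord_recl big_ord1;
  congr (_ + x _ _ *: delta_mx _ _); apply/val_inj.
Qed.

Definition comb {n} (p q : 'rV[R]_n) x : 'rV[R]_n := x 0 0 *: p + x 0 1 *: q.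

Lemma comb_linear {n} (p q : 'rV[R]_n) : linear (comb p q).
Proof.
move=> a x y; rewrite /comb !mxE !scalerDl !scalerDr !scalerA.
by rewrite addrACA.
Qed.

HB.instance Definition _ n (p q : 'rV[R]_n) :=
  GRing.isLinear.Build R _ _ _ (comb p q) (comb_linear p q).

Definition det2 (p q : 'rV[R]_2) : R := p 0 0 * q 0 1 - p 0 1 * q 0 0.

(** Cramer's rule for [z] in terms of [p] and [q], seen through [f]; it evaluates the determinant of
    a rank one perturbation in [nested_two]. *)
Lemma det2_cramer f p q z :
  dot f q * det2 p z + dot f p * det2 z q = dot f z * det2 p q.
Proof. by rewrite !dot2E /det2; ring. Qed.

(** A linear map is encoded by the images [p], [q] of the coordinate vectors. These lie in [L] when
    [K] is sent into [L], so the admissible pairs form a compact set and the determinant attains its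
    maximum. *)
Lemma max_position K L : sym_body K -> sym_body L ->
  exists p q, [/\ forall x, K x -> L (comb p q x), 0 < det2 p q &
    forall p' q', (forall x, K x -> L (comb p' q' x)) ->
      det2 p' q' <= det2 p q].
Proof.
move=> bK bL; have [cL _ _ eL] := bL; have [_ _ _ eK] := bK.
pose S := (L `*` L) `&` \bigcap_(x in K) [set pq | L (comb pq.1 pq.2 x)].
have SP p q : (forall x, K x -> L (comb p q x)) -> S (p, q).
  move=> h; split; last by move=> x /=; exact: h.
  have := h _ (eK 0); have := h _ (eK 1).
  by rewrite /comb !mxE /= !scale0r !scale1r add0r addr0.
have cS : compact S.
  apply: compact_closedI; first exact: compact_setX.
  apply: closed_bigI => x _; apply: preimage_closed; last first.
    exact: compact_closed (@norm_hausdorff _ _) cL.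
  move=> pq _; rewrite /comb; apply: cvgD.
    by apply: cvgZl_tmp; exact: cvg_fst.
  by apply: cvgZl_tmp; exact: cvg_snd.
have cdet : continuous (fun pq : 'rV[R]_2 * 'rV[R]_2 => det2 pq.1 pq.2).
  have c1 i : continuous (fun pq : 'rV[R]_2 * 'rV[R]_2 => pq.1 0 i).
    move=> pq; apply: (@continuous_comp _ _ _ fst (fun x => x 0 i)).
      exact: cvg_fst.
    exact: coord_continuous.
  have c2 i : continuous (fun pq : 'rV[R]_2 * 'rV[R]_2 => pq.2 0 i).
    move=> pq; apply: (@continuous_comp _ _ _ snd (fun x => x 0 i)).
      exact: cvg_snd.
    exact: coord_continuous.
  move=> pq; apply: cvgB; apply: cvgM.
  - exact: c1.
  - exact: c2.
  - exact: c1.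
  - exact: c2.
have nz i : delta_mx 0 i != 0 :> 'rV[R]_2.
  apply/eqP => /rowP/(_ i); rewrite !mxE !eqxx => /eqP.
  by rewrite oner_eq0.
have [c0 [_ [c0_gt0 _ _ hc0]]] := sym_body_norming bK (nz 0).
have [c1 [_ [c1_gt0 _ _ hc1]]] := sym_body_norming bK (nz 1).
(* [e] times the identity sends [K] into [L], which makes the maximal determinant positive. *)
pose e := (c0 + c1)^-1.
have e0 : 0 < e by rewrite invr_gt0 addr_gt0.
have Se : S (e *: delta_mx 0 0, e *: delta_mx 0 1).
  apply: SP => x Kx; rewrite /comb !scalerA; apply: sym_body_comb => //.
  have := hc0 _ Kx; have := hc1 _ Kx; rewrite !(dotC (delta_mx _ _)) !dot_delta.
  move=> h1 h0; rewrite !normrM !(gtr0_norm e0) -mulrDl.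
  by rewrite ler_pdivrMr ?mul1r ?addr_gt0 // lerD.
have [] := compact_EVT_max (ex_intro _ _ Se) cS (continuous_subspaceT cdet).
move=> [p q] /set_mem [_ Spq] pqmax.
exists p, q; split=> [x Kx||p' q' /SP h]; first exact: Spq.
  apply: lt_le_trans (pqmax _ (mem_set Se)); rewrite /det2 !mxE /=.
  by rewrite !mulr1 !mulr0 subr0 mulr_gt0.
exact: (pqmax (p', q') (mem_set h)).
Qed.

(* If [z] in [L] were outside [2 M K], a functional [f] would satisfy
   [f z = 1] and [|f| <= c < 1/2] on [M K]; then the maps
   [(1 - e c) M + e f(M .) z] still send [K] into [L], but have determinant
   [(1 - e c) (1 + e (1 - c)) det M], which is larger for small [e]. *)
Lemma nested_two K L : sym_body K -> sym_body L -> nested K L 2.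
Proof.
move=> bK bL; have [p [q [KL D0 Dmax]]] := max_position bK bL.
exists (comb p q); split=> // z Lz; apply: contrapT => nz.
have [cK convK sK eK] := bK.
pose W := [set w - 2^-1 *: z | w in comb p q @` K].
have [||||f fW] := @separation0 _ _ W.
- exists (comb p q (delta_mx 0 0) - 2^-1 *: z).
  by do 2! eexists => //; exact: eK.
- apply: continuous_compact.
    by apply: continuous_subspaceT; exact: add_cst_continuous.
  apply: continuous_compact => //.
  by apply: continuous_subspaceT; exact: linear_rV_continuous.
- apply/convex_setP => _ _ a b a0 b0 ab [_ [x Kx <-] <-] [_ [y Ky <-] <-].
  exists (comb p q (a *: x + b *: y)).
    by exists (a *: x + b *: y) => //; move/convex_setP: convK; exact.
  by rewrite !scalerBr addrACA -opprD -scalerDl ab scale1r linearD !linearZ.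
- move=> [_ [k Kk <-]] /eqP; rewrite subr_eq0 => /eqP kz.
  apply: nz; exists k => //=; rewrite kz scalerA divff ?scale1r //.
have fz : 0 < - dot f z.
  have := fW _ (ex_intro2 _ _ _ (ex_intro2 _ _ _ (eK 0) erefl) erefl).
  have := fW _ (ex_intro2 _ _ _ (ex_intro2 _ _ _ (sK _ (eK 0)) erefl) erefl).
  by rewrite linearN /= !dotB dotN dotZ; lra.
pose g := (dot f z)^-1 *: f.
have gz : dot g z = 1 by rewrite dotZl mulVf //; lra.
have [k0 /set_mem Kk0 k0max] : exists2 k, k \in K &
    forall k', k' \in K -> dot g (comb p q k') <= dot g (comb p q k).
  apply: compact_EVT_max => //; first by exists (delta_mx 0 0); exact: eK.
  apply: continuous_subspaceT => x; apply: continuous_comp.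
    exact: linear_rV_continuous.
  exact: dot_continuous.
set c := dot g _ in k0max.
have gc k : K k -> `|dot g (comb p q k)| <= c.
  move=> Kk; rewrite ler_norml lerNl -dotN -linearN /=.
  by rewrite !k0max //; apply/mem_set => //; exact: sK.
have c0 : 0 <= c by apply: le_trans (gc _ Kk0); exact: normr_ge0.
have c2 : c < 2^-1.
  have := fW _ (ex_intro2 _ _ _ (ex_intro2 _ _ _ Kk0 erefl) erefl).
  rewrite dotB dotZ /c dotZl ltr_ndivrMl; last by lra.
  by rewrite mulrC; lra.
(* The determinant grows by the factor [1 + e * (1 - 2 * c - e * (c * (1 - c)))], which exceeds 1
   for this [e]. *)
pose e : R := (1 - 2 * c) / 2.
have e0 : 0 < e by rewrite /e; lra.
have e1 : e <= 2^-1 by rewrite /e; lra.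
pose h w := (1 - e * c) *: w + (e * dot g w) *: z.
have := Dmax (h p) (h q).
have -> : det2 (h p) (h q) = (1 - e * c) * (1 + e * (1 - c)) * det2 p q.
  have <- : (1 - e * c) * ((1 - e * c) * det2 p q +
      e * (dot g q * det2 p z + dot g p * det2 z q)) =
      (1 - e * c) * (1 + e * (1 - c)) * det2 p q.
    by rewrite det2_cramer gz; ring.
  by rewrite /h /det2 !mxE; ring.
rewrite leNgt => /(_ _)/negP; apply => [x Kx|].
  have -> : comb (h p) (h q) x = h (comb p q x).
    by apply/rowP => i; rewrite /h /comb dotD !dotZ !mxE; ring.
  apply: sym_body_comb => //; first exact: KL.
  have ec : e * c <= 2^-1 * 2^-1 by apply: ler_pM => //; exact: ltW.
  have ec1 : 0 <= 1 - e * c by lra.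
  rewrite normrM (gtr0_norm e0) (ger0_norm ec1).
  by have := ler_wpM2l (ltW e0) (gc _ Kx); lra.
rewrite ltr_pMl //.
suff : 0 < e * (1 - 2 * c - e * (c * (1 - c))) by lra.
by apply: mulr_gt0 => //; rewrite /e; nra.
Qed.

(** * A cone squeezed between another cone and its dilate *)

Definition in_cone K x (t : R) :=
  0 <= t <= 1 /\ exists2 y, K y & x = (1 - t) *: y.

Lemma in_cone_base K x : K x -> in_cone K x 0.
Proof. by move=> Kx; split; [lra|exists x; rewrite // subr0 scale1r]. Qed.

Lemma in_cone_apex K : K !=set0 -> in_cone K 0 1.
Proof. by case=> y Ky; split; [lra|exists y; rewrite // subrr scale0r]. Qed.

Lemma orthogonal_exists x : exists2 f : 'rV[R]_2, f != 0 & dot f x = 0.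
Proof.
have [->|x0] := eqVneq x 0.
  exists (delta_mx 0 0); last exact: dot0.
  by apply/eqP => /rowP/(_ 0); rewrite !mxE !eqxx => /eqP; rewrite oner_eq0.
exists (x 0 1 *: delta_mx 0 0 - x 0 0 *: delta_mx 0 1); last first.
  by rewrite dot2E !mxE /=; ring.
apply: contra x0 => /eqP /rowP h; rewrite (row2E x).
have := h 0; have := h 1; rewrite !mxE /= => h1 h0.
have -> : x 0 0 = 0 by lra.
have -> : x 0 1 = 0 by lra.
by rewrite !scale0r addr0.
Qed.

Lemma linear_form_continuous (l : {linear 'rV[R]_2 -> R^o}) :
  continuous (l : 'rV[R]_2 -> R).
Proof.
have -> : (l : _ -> R) = dot (\row_i l (delta_mx 0 i)).
  apply/funext => x; rewrite {1}(row_sum_delta x) linear_sum.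
  by apply: eq_bigr => i _; rewrite linearZ /= mxE mulrC.
exact: dot_continuous.
Qed.

(* The base of the inner cone is [(xc, tc) + (L, l) K1], its apex [(xv, s)]. *)
Section ConeInCone.
Variables (K1 K2 : set 'rV[R]_2) (bK1 : sym_body K1) (bK2 : sym_body K2).
Variables (L : {linear 'rV[R]_2 -> 'rV[R]_2}) (l : {linear 'rV[R]_2 -> R^o}).
Variables (xc xv xw : 'rV[R]_2) (tc s tw rho : R).

Hypothesis base_in : forall k, K1 k -> in_cone K2 (xc + L k) (tc + l k).
Hypothesis apex_in : in_cone K2 xv s.
Hypothesis cover : forall x t, in_cone K2 x t ->
  exists k tau, [/\ K1 k, 0 <= tau <= 1,
    x = rho *: ((1 - tau) *: (xc + L k) + tau *: xv) + xw &
    t = rho * ((1 - tau) * (tc + l k) + tau * s) + tw].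

Lemma in_cone_dot g x t :
  (forall y, K2 y -> `|dot g y| <= 1) -> in_cone K2 x t -> `|dot g x| <= 1 - t.
Proof.
move=> g1 [/andP[t0 t1] [y Ky ->]]; rewrite dotZ normrM ger0_norm ?subr_ge0 //.
by rewrite ler_piMr ?subr_ge0 ?g1.
Qed.

(* The three functionals [1 - t + g x], [1 - t - g x] and [t] cut out a
   triangle circumscribed about the projection of the covered cone. *)
Lemma triangle_bound g y0 (Mp Mm Mt : R) : K2 y0 -> dot g y0 = 1 ->
  (forall k, K1 k -> [/\ 1 - (tc + l k) + dot g (xc + L k) <= Mp,
     1 - (tc + l k) - dot g (xc + L k) <= Mm & tc + l k <= Mt]) ->
  [/\ 1 - s + dot g xv <= Mp, 1 - s - dot g xv <= Mm & s <= Mt] ->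
  0 <= rho -> 2 <= rho * ((Mp + Mm) / 2 + Mt - 1).
Proof.
move=> Ky0 gy0 baseM [Vp Vm Vt] rho0.
have [_ _ sK2 _] := bK2.
have mono a b c tau : 0 <= tau <= 1 -> a <= c -> b <= c ->
    rho * ((1 - tau) * a + tau * b) <= rho * c.
  by move=> /andP[h0 h1] ac bc; apply: ler_wpM2l => //; nra.
(* The points [y0], [- y0] of the base and the apex, where the functionals equal 2, 2 and 1, are
   covered. Weights 1/2, 1/2 and 1 on the three inequalities cancel the translation [xw], [tw]. *)
have [k [tau [/baseM[kp _ _] tau01 /(congr1 (dot g)) + tE]]] :=
  cover (in_cone_base Ky0).
rewrite gy0 dotD dotZ dotD !dotZ => gE.
have hp := mono _ _ _ _ tau01 kp Vp.
have [k' [tau' [/baseM[_ km _] tau01' /(congr1 (dot g)) + tE']]] :=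
  cover (in_cone_base (sK2 _ Ky0)).
rewrite dotN gy0 dotD dotZ dotD !dotZ => gE'.
have hm := mono _ _ _ _ tau01' km Vm.
have [k3 [tau3 [/baseM[_ _ kt] tau013 _ tE3]]] :=
  cover (in_cone_apex (ex_intro _ _ Ky0)).
have ht := mono _ _ _ _ tau013 kt Vt.
lra.
Qed.

(** On the covered base [g] takes the values 1 and -1, while on the inner cone it stays within [m]
    of [dot g xc], since the apex has that same value. *)
Lemma width_bound g y0 (m : R) : K2 y0 -> dot g y0 = 1 ->
  (forall k, K1 k -> `|dot g (L k)| <= m) -> dot g xv = dot g xc ->
  0 <= rho -> 1 <= rho * m.
Proof.
move=> Ky0 gy0 Lm gv rho0.
have [_ _ sK2 _] := bK2.
have shrink k tau : K1 k -> 0 <= tau <= 1 ->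
    `|rho * ((1 - tau) * dot g (L k))| <= rho * m.
  move=> /Lm h /andP[h0 h1]; rewrite normrM (ger0_norm rho0) ler_wpM2l //.
  rewrite normrM ger0_norm ?subr_ge0 //.
  by have := normr_ge0 (dot g (L k)); nra.
have [k [tau [Kk tau01 /(congr1 (dot g)) + _]]] := cover (in_cone_base Ky0).
rewrite gy0 dotD dotZ dotD !dotZ dotD gv => gE.
have [k' [tau' [Kk' tau01' /(congr1 (dot g)) + _]]] :=
  cover (in_cone_base (sK2 _ Ky0)).
rewrite dotN gy0 dotD dotZ dotD !dotZ dotD gv => gE'.
have := shrink _ _ Kk tau01; have := shrink _ _ Kk' tau01'.
by rewrite !ler_norml; lra.
Qed.

Lemma bodyN k : K1 k -> K1 (- k).
Proof. by case: bK1 => _ _ sK _ /sK. Qed.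

(* [2 c - v] is the reflection of the apex [v] in the centre [c] of the base. *)
Lemma reflected_apex_above : 0 <= 2 * tc - s -> 0 <= rho -> 2 <= rho.
Proof.
move=> y0 rho0; have [y1|y1] := leP (2 * tc - s) 1.
  have [f f0 fy] := orthogonal_exists (2 *: xc - xv).
  have [c [z [c0 Kz gz g1]]] := sym_body_normed bK2 f0.
  have : dot (c *: f) (2 *: xc - xv) = 0 by rewrite dotZl fy mulr0.
  set g := c *: f in gz g1 *; rewrite dotB dotZ => gy.
  (* Each functional is nonnegative at the reflection in [c] of a base point or of the apex, hence
     at most twice its value at [c]. At [2 c - v] this holds because [g] vanishes there and the
     height is in [0, 1]. *)
  have := @triangle_bound g z (2 * (1 - tc + dot g xc))
    (2 * (1 - tc - dot g xc)) (2 * tc) Kz gz _ _ rho0.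
  rewrite (_ : (_ + _) / 2 + _ - 1 = 1) ?mulr1; last by field.
  apply=> [k Kk|]; last by split; lra.
  have := in_cone_dot g1 (base_in (bodyN Kk)).
  have [/andP[t0 t1] _] := base_in (bodyN Kk); move: t0 t1.
  by rewrite !linearN !dotD !dotN ler_norml => *; split; lra.
(* Here [tc > 1/2], as [s >= 0]. Combining the bounds on [g] at the opposite base points for [k] and
   [- k] gives half-width at most [1 - tc < 1/2]. *)
have [f f0 fy] := orthogonal_exists (xv - xc).
have [c [z [c0 Kz gz g1]]] := sym_body_normed bK2 f0.
have : dot (c *: f) (xv - xc) = 0 by rewrite dotZl fy mulr0.
set g := c *: f in gz g1 *; rewrite dotB => gy.
have := @width_bound g z (1 - tc) Kz gz _ _ rho0.
have [/andP[s0 s1] _] := apex_in.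
suff Lm k : K1 k -> `|dot g (L k)| <= 1 - tc.
  have gvc : dot g xv = dot g xc by lra.
  by move=> /(_ Lm gvc); nra.
move=> Kk; have := in_cone_dot g1 (base_in (bodyN Kk)).
have := in_cone_dot g1 (base_in Kk).
by rewrite !linearN !dotD !dotN !ler_norml; lra.
Qed.

(* The projection along the common direction [(y, -1)] is [x + t y]. *)
Lemma common_direction k0 y : K1 k0 -> K2 y ->
  xc + L k0 - xv = (s - (tc + l k0)) *: y -> nested K1 K2 rho.
Proof.
move=> Kk0 Ky k0y.
have [[_ /convex_setP cK1 sK1 _] [_ /convex_setP cK2 sK2 _]] := (bK1, bK2).
have proj x t : in_cone K2 x t -> K2 (x + t *: y).
  by move=> [/andP[t0 t1] [z Kz ->]]; apply: cK2 => //; lra.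
have Mlin : linear (fun k => L k + l k *: y).
  move=> a x z; rewrite !linearP /= scalerDl !scalerDr !scalerA.
  by rewrite addrACA.
pose M : {linear 'rV[R]_2 -> 'rV[R]_2} :=
  HB.pack (fun k => L k + l k *: y) (GRing.isLinear.Build _ _ _ _ _ Mlin).
have ME k : M k = L k + l k *: y by [].
pose d := xc + tc *: y.
have dM k : K1 k -> K2 (d + M k).
  move=> /base_in/proj; rewrite /d /= scalerDl.
  by rewrite addrACA.
(* The apex projects onto the image of the base point [k0], so the inner cone and its base have the
   same projection. *)
have Vproj : xv + s *: y = d + M k0.
  have -> : xv = xc + L k0 - (s - (tc + l k0)) *: y by rewrite -k0y subKr.
  by apply/rowP => i; rewrite /d !mxE /=; ring.
have cov x : K2 x -> exists2 k, K1 k & x = rho *: (d + M k) + (xw + tw *: y).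
  move=> Kx; have [k [tau [Kk /andP[h0 h1] xE tE]]] := cover (in_cone_base Kx).
  exists ((1 - tau) *: k + tau *: k0); first by apply: cK1 => //; lra.
  have -> : x = x + 0 *: y by rewrite scale0r addr0.
  have : (rho * tau) *: (xv + s *: y) = (rho * tau) *: (d + M k0).
    by rewrite Vproj.
  have -> : M ((1 - tau) *: k + tau *: k0) = (1 - tau) *: M k + tau *: M k0.
    by rewrite linearD !linearZ.
  rewrite {1}xE {1}tE !ME => /rowP h.
  by apply/rowP => i; have := h i; rewrite /d !mxE; lra.
(* Half the difference of the relations at opposite points removes the translations. *)
exists M; split=> [k Kk|x Kx].
  have -> : M k = 2^-1 *: (d + M k) + 2^-1 *: - (d + M (- k)).
    by apply/rowP => i; rewrite (linearN M) !mxE; field.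
  by apply: cK2; [lra|lra|lra|exact: dM|apply: sK2; apply: dM; exact: sK1].
have [k Kk xE] := cov _ Kx; have [k' Kk' xE'] := cov _ (sK2 _ Kx).
exists (2^-1 *: k + (- 2^-1) *: k').
  by apply: sym_body_comb; rewrite // normrN ger0_norm; lra.
have -> : M (2^-1 *: k + (- 2^-1) *: k') = 2^-1 *: M k + (- 2^-1) *: M k'.
  by rewrite linearD !linearZ.
move: xE xE' => /rowP h /rowP h'.
by apply/rowP => i; have := h i; have := h' i; rewrite !mxE; lra.
Qed.

(* Here [w] vanishes at a segment from the apex [v] to the base that is parallel
   to a segment of the covered cone; if there is none, 0 is separated from [W],
   which makes [1 - t - g x] and [t] maximal at [v]. *)
Lemma reflected_apex_below :
  2 * tc - s < 0 -> 0 <= rho -> 2 <= rho \/ nested K1 K2 rho.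
Proof.
move=> y0 rho0.
have [cK1 /convex_setP vK1 sK1 eK1] := bK1.
have [cK2 /convex_setP vK2 sK2 eK2] := bK2.
(* The height at [- k] is nonnegative, so [l k <= tc] and [tc + l k <= 2 * tc < s]. *)
have top k : K1 k -> tc + l k < s.
  by move=> /bodyN/base_in[+ _]; rewrite linearN; lra.
pose w (ky : 'rV[R]_2 * 'rV[R]_2) :=
  xc + L ky.1 - xv + (tc + l ky.1 - s) *: ky.2.
pose W := w @` (K1 `*` K2).
have [W0|nW0] := pselect (W 0).
  have [[k y] /= [Kk Ky] /eqP] := W0; rewrite addr_eq0 => /eqP ky.
  by right; apply: (@common_direction k y) => //; rewrite ky -scaleNr opprB.
left; have [|||f fW] := @separation0 _ _ W _ _ _ nW0.
- exists (w (delta_mx 0 0, delta_mx 0 0)).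
  by exists (delta_mx 0 0, delta_mx 0 0) => //; split; [exact: eK1|exact: eK2].
- apply: continuous_compact; last exact: compact_setX.
  apply: continuous_subspaceT; apply: continuous_rVD.
    apply: continuous_rVD; last exact: cst_continuous.
    apply: continuous_rVD; first exact: cst_continuous.
    move=> ky; apply: (@continuous_comp _ _ _ fst L); first exact: cvg_fst.
    exact: linear_rV_continuous.
  apply: continuous_rVZ => ky; last exact: cvg_snd.
  apply: cvgB; last exact: cvg_cst.
  apply: cvgD; first exact: cvg_cst.
  apply: (@continuous_comp _ _ _ fst l); first exact: cvg_fst.
  exact: linear_form_continuous.
- apply/convex_setP.
  move=> _ _ a b a0 b0 ab [[k y] /= [Kk Ky] <-] [[k' y'] /= [Kk' Ky'] <-].
  have [kt kt'] := (top _ Kk, top _ Kk').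
  pose c := s - (tc + l k); pose c' := s - (tc + l k').
  have c0 : 0 < c by rewrite subr_gt0.
  have c0' : 0 < c' by rewrite subr_gt0.
  (* In [w] the vector [y] is scaled by the drop [c] from the apex, so [y] and [y'] must be
     recombined with weights proportional to [a * c] and [b * c']. *)
  pose d := a * c + b * c'.
  have d0 : 0 < d.
    have [a_gt0|a_le0] := ltP 0 a.
      by rewrite /d ltr_pwDl ?mulr_gt0 // mulr_ge0 // ltW.
    have aE : a = 0 by apply/eqP; rewrite eq_le a_le0.
    by rewrite /d aE mul0r add0r mulr_gt0 //; lra.
  exists (a *: k + b *: k', (a * c / d) *: y + (b * c' / d) *: y').
    split; first exact: vK1.
    apply: vK2 => //; try by rewrite divr_ge0 ?mulr_ge0 // ltW.
    by rewrite -mulrDl divff // gt_eqF.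
  have LE : L (a *: k + b *: k') = a *: L k + b *: L k'.
    by rewrite linearD !linearZ.
  have lE : l (a *: k + b *: k') = a * l k + b * l k'.
    by rewrite linearD !linearZ.
  rewrite /w /= LE lE.
  have -> : tc + (a * l k + b * l k') - s = - d.
    by rewrite /d /c /c'; have -> : a = 1 - b by [lra]; ring.
  rewrite scalerDr !scalerA !mulNr ![d * _]mulrC !divfK ?gt_eqF //.
  apply/rowP => i; rewrite /c /c' !mxE.
  by have -> : a = 1 - b by [lra]; ring.
have fE k y : K1 k -> K2 y ->
    (s - (tc + l k)) * dot f y < dot f (xc + L k) - dot f xv.
  move=> Kk Ky; have := fW _ (ex_intro2 _ _ (k, y) (conj Kk Ky) erefl).
  by rewrite /w dotD dotB dotZ /=; lra.
have f0 : f != 0.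
  apply/eqP => f0; have := fE _ _ (eK1 0) (eK2 0).
  by rewrite f0 !(dotC 0) !dot0 mulr0 subrr ltxx.
have [c [z [c0 Kz gz g1]]] := sym_body_normed bK2 f0.
have gE k : K1 k -> s - (tc + l k) <= dot (c *: f) (xc + L k) - dot (c *: f) xv.
  move=> Kk; have := ler_wpM2l (ltW c0) (ltW (fE _ _ Kk Kz)).
  by rewrite mulrCA -dotZl gz mulr1 mulrBr -!dotZl.
set g := c *: f in gz g1 gE.
have [/andP[s0 s1] _] := apex_in.
have := in_cone_dot g1 apex_in; rewrite ler_norml => /andP[gv gv'].
(* The functional [1 - t + g x] is at most 2 on the covered cone. With these maxima the bound
   becomes [rho * (1 + s - dot g xv) / 2], at most [rho] because [- dot g xv <= 1 - s]. *)
have := @triangle_bound g z 2 (1 - s - dot g xv) s Kz gz _ _ rho0.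
move=> h; apply: le_trans (h _ _) _ => [k Kk||].
- have [/andP[t0 t1] _] := base_in Kk.
  have := in_cone_dot g1 (base_in Kk); rewrite ler_norml => /andP[gk gk'].
  by have := gE _ Kk; have := top _ Kk; split; lra.
- by split; lra.
- by rewrite ler_piMr //; lra.
Qed.

Lemma cone_in_cone : 0 <= rho -> 2 <= rho \/ nested K1 K2 rho.
Proof.
move=> rho0; have [h|h] := leP 0 (2 * tc - s); last exact: reflected_apex_below.
by left; exact: reflected_apex_above.
Qed.

End ConeInCone.

(** * Linear inverses, and ratios without translations *)

Lemma linear_left_inverse m n (S : {linear 'rV[R]_m -> 'rV[R]_n}) :
  injective S -> exists M : {linear 'rV[R]_n -> 'rV[R]_m}, cancel S M.
Proof.
move=> Sinj.
have k0 : lker (linfun S) == 0%VS.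
  by apply/lker0P => x y; rewrite !lfunE; exact: Sinj.
pose h := ((linfun S)^-1)%VF.
have SK : cancel S h by move=> x; rewrite -(lfunE S x) /h lker0_lfunK.
by exists h.
Qed.

Lemma linear_inverse n (S : {linear 'rV[R]_n -> 'rV[R]_n}) : injective S ->
  exists M : {linear 'rV[R]_n -> 'rV[R]_n}, cancel S M /\ cancel M S.
Proof.
move=> Sinj.
have k0 : lker (linfun S) == 0%VS.
  by apply/lker0P => x y; rewrite !lfunE; exact: Sinj.
pose h := ((linfun S)^-1)%VF.
have SK : cancel S h by move=> x; rewrite -(lfunE S x) /h lker0_lfunK.
have KS : cancel h S by move=> x; rewrite -(lfunE S) /h lker0_lfunVK.
by exists h.
Qed.

Lemma linear_cancelC n (S M : {linear 'rV[R]_n -> 'rV[R]_n}) :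
  cancel S M -> cancel M S.
Proof.
move=> SM; have [S' [SS' S'S]] := linear_inverse (can_inj SM).
by move=> x; rewrite -{1}(S'S x) SM S'S.
Qed.

(** The inverse of [T] serves as the map: half the difference of the points found for opposite
    arguments is again in the body and is free of [u] and [v]. *)
Lemma BM_ratio_nested K L (rho : R) : sym_body K -> sym_body L ->
  BM_ratio K L rho -> nested K L rho.
Proof.
move=> bK bL [rho0 [T [u [v [Tb KT TK]]]]].
have [[_ _ sK _] [_ _ sL _]] := (bK, bL).
have [M [TM MT]] := linear_inverse (bij_inj Tb).
have half A (x y : 'rV[R]_2) :
    sym_body A -> A x -> A y -> A (2^-1 *: x + (- 2^-1) *: y).
  by move=> bA Ax Ay; apply: sym_body_comb; rewrite // normrN ger0_norm; lra.
have ML k : K k -> exists2 y, L y & M k = y + v - M u.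
  move=> Kk; have [|_ [y Ly <-] /(congr1 M)] := KT (k + u); first by exists k.
  by rewrite TM linearD => yE; exists y; rewrite // yE addrK.
have TLK y : L y -> exists2 k, K k & T y = rho *: (k + u) - T v.
  move=> Ly; have [|_ [k Kk <-] kE] := TK (T (y + v)).
    by exists (y + v) => //; exists y.
  by exists k; rewrite // kE (linearD T) addrK.
exists M; split=> [k Kk|y Ly].
  have [[y Ly yE] [y' Ly' yE']] := (ML _ Kk, ML _ (sK _ Kk)).
  have -> : M k = 2^-1 *: y + (- 2^-1) *: y'.
    move: yE'; rewrite linearN => /rowP h'; move: yE => /rowP h.
    by apply/rowP => i; have := h i; have := h' i; rewrite !mxE; lra.
  exact: half.
have [[k Kk kE] [k' Kk' kE']] := (TLK _ Ly, TLK _ (sL _ Ly)).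
exists (2^-1 *: k + (- 2^-1) *: k'); first exact: half.
rewrite -linearZ /= -[LHS]TM; congr (M _).
move: kE'; rewrite linearN => /rowP h'; move: kE => /rowP h.
by apply/rowP => i; have := h i; have := h' i; rewrite !mxE; lra.
Qed.

Lemma nested_ge1 K L (rho : R) : sym_body L -> 0 <= rho -> nested K L rho ->
  1 <= rho.
Proof.
move=> bL rho0 [M [KL LK]]; have [f f0 _] := orthogonal_exists (0 : 'rV[R]_2).
have [c [y [_ Ly gy g1]]] := sym_body_normed bL f0.
have [k Kk yE] := LK _ Ly; move: gy; rewrite yE dotZ => <-.
by rewrite ler_piMr //; exact: le_trans (ler_norm _) (g1 _ (KL _ Kk)).
Qed.

(** The coordinate vectors lie in [L], hence in the range of [M]. *)
Lemma nested_inverse K L (M : {linear 'rV[R]_2 -> 'rV[R]_2}) (rho : R) :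
  sym_body L -> (forall y, L y -> exists2 k, K k & y = rho *: M k) ->
  exists S : {linear 'rV[R]_2 -> 'rV[R]_2}, cancel S M /\ cancel M S.
Proof.
move=> [_ _ _ eL] LK.
have [[k0 _ e0] [k1 _ e1]] := (LK _ (eL 0), LK _ (eL 1)).
exists (comb (rho *: k0) (rho *: k1)).
suff SM : cancel (comb (rho *: k0) (rho *: k1)) M.
  by split=> //; exact: linear_cancelC SM.
by move=> x; rewrite /comb linearD !linearZ /= -e0 -e1 -row2E.
Qed.

Lemma translate0 n (A : set 'rV[R]_n) : translate A 0 = A.
Proof.
apply/seteqP; split=> [_ [x Ax <-]|x Ax]; first by rewrite addr0.
by exists x; rewrite ?addr0.
Qed.

Lemma nested_BM_ratio K L (rho : R) : sym_body L -> 0 <= rho ->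
  nested K L rho -> BM_ratio K L rho.
Proof.
move=> bL rho0 [M [KL LK]]; have [S [SM MS]] := nested_inverse bL LK.
split=> //; exists S, 0, 0; rewrite !translate0; split.
- by exists M.
- by move=> k Kk; exists (M k); [exact: KL|exact: MS].
- move=> _ [y Ly <-]; have [k Kk ->] := LK _ Ly.
  by exists k; rewrite // linearZ /= MS.
Qed.

(** * Cones in space and their distance *)

Definition base {n} (p : 'rV[R]_n.+1) : 'rV[R]_n := \row_i p 0 (lift ord_max i).
Definition height {n} (p : 'rV[R]_n.+1) : R^o := p 0 ord_max.
Definition stack {n} (x : 'rV[R]_n) (t : R) : 'rV[R]_n.+1 :=
  \row_j if unlift ord_max j is Some i then x 0 i else t.

Lemma base_linear n : linear (@base n).
Proof. by move=> a x y; apply/rowP => i; rewrite !mxE. Qed.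

Lemma height_linear n : linear (@height n).
Proof. by move=> a x y; rewrite /height !mxE. Qed.

HB.instance Definition _ n :=
  GRing.isLinear.Build R _ _ _ (@base n) (@base_linear n).
HB.instance Definition _ n :=
  GRing.isLinear.Build R _ _ _ (@height n) (@height_linear n).

Lemma base_stack n (x : 'rV[R]_n) t : base (stack x t) = x.
Proof. by apply/rowP => i; rewrite !mxE liftK. Qed.

Lemma height_stack n (x : 'rV[R]_n) t : height (stack x t) = t.
Proof. by rewrite /height mxE unlift_none. Qed.

Lemma stackE n (p : 'rV[R]_n.+1) : stack (base p) (height p) = p.
Proof.
by apply/rowP => j; rewrite mxE; case: unliftP => [i|] ->; rewrite ?mxE.
Qed.

Lemma stack_linear n a (x y : 'rV[R]_n) t s :
  stack (a *: x + y) (a * t + s) = a *: stack x t + stack y s.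
Proof.
by apply/rowP => j; rewrite !mxE; case: unliftP => [i|] _; rewrite ?mxE.
Qed.

Definition on_base n (F : {linear 'rV[R]_n -> 'rV[R]_n}) (p : 'rV[R]_n.+1) :=
  stack (F (base p)) (height p).

Lemma on_base_linear n F : linear (@on_base n F).
Proof. by move=> a p q; rewrite /on_base !linearP stack_linear. Qed.

Lemma on_baseK n (F G : {linear 'rV[R]_n -> 'rV[R]_n}) :
  cancel F G -> cancel (on_base F) (on_base G).
Proof.
by move=> FG p; rewrite /on_base base_stack height_stack FG stackE.
Qed.

HB.instance Definition _ n F :=
  GRing.isLinear.Build R _ _ _ (@on_base n F) (@on_base_linear n F).

(* The base lies at height 0 and the apex at height 1. *)
Definition cone K : set 'rV[R]_3 := [set p | in_cone K (base p) (height p)].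

(** The planar map is extended by the identity on heights. If [y = rho *: M k], the point over
    [(1 - t) *: y] at height [t] is [rho] times the one over [(1 - t) *: M k] at height [t / rho],
    and the slice there is large enough since [rho >= 1]. *)
Lemma nested_cone K L (rho : R) : sym_body K -> sym_body L -> 0 <= rho ->
  nested K L rho -> BM_ratio (cone K) (cone L) rho.
Proof.
move=> bK bL rho0 KL; have rho1 := nested_ge1 bL rho0 KL.
have [M [ML LM]] := KL; have [S [SM MS]] := nested_inverse bL LM.
split=> //; exists (on_base S), 0, 0; rewrite !translate0; split.
- by exists (on_base M); exact: on_baseK.
- move=> p [t01 [k Kk pE]]; exists (on_base M p); last exact: on_baseK.
  rewrite /cone /= /on_base base_stack height_stack; split=> //.
  by exists (M k); [exact: ML|rewrite pE linearZ].
- move=> _ [q [/andP[t0 t1] [y Ly qE]] <-]; rewrite /= /on_base qE.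
  set t : R := height q in t0 t1 *.
  have [k Kk ->] := LM _ Ly.
  have r0 : 0 < rho by lra.
  exists (stack ((1 - t) *: k) (t / rho)); last first.
    have := stack_linear rho ((1 - t) *: k) 0 (t / rho) 0.
    have -> : stack 0 0 = 0 :> 'rV[R]_3.
      by apply/rowP => j; rewrite !mxE; case: unliftP => [i|] _; rewrite ?mxE.
    rewrite !addr0 => <-; congr stack; last by rewrite mulrC divfK ?gt_eqF.
    by rewrite !linearZ /= MS !scalerA mulrC.
  have tr0 : 0 <= t / rho by rewrite divr_ge0.
  have tr1 : t / rho <= t by rewrite ler_pdivrMr // ler_peMr.
  rewrite /cone /= base_stack height_stack; split; first by lra.
  have [e|e] := eqVneq (1 - t / rho) 0.
    have t1E : 1 - t = 0 by lra.
    by exists k; rewrite // e t1E.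
  have e0 : 0 < 1 - t / rho by rewrite lt_def e; lra.
  exists (((1 - t) / (1 - t / rho)) *: k); last first.
    by rewrite scalerA mulrC divfK.
  apply: sym_body_scale => //; rewrite ger0_norm; last by rewrite divr_ge0; lra.
  by rewrite ler_pdivrMr //; lra.
Qed.

Lemma cone_BM_ratio K L (rho : R) : sym_body K -> sym_body L ->
  BM_ratio (cone K) (cone L) rho -> 2 <= rho \/ nested K L rho.
Proof.
move=> bK bL [rho0 [T [u [v [Tb KT TK]]]]].
have [S [TS ST]] := linear_inverse (bij_inj Tb).
have emblin : linear (fun k : 'rV[R]_2 => stack k 0).
  by move=> a x y; rewrite -stack_linear mulr0 addr0.
pose emb : {linear 'rV[R]_2 -> 'rV[R]_3} :=
  HB.pack (fun k : 'rV[R]_2 => stack k 0)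
    (GRing.isLinear.Build _ _ _ _ _ emblin).
have embE k : emb k = stack k 0 by [].
(* The inner cone is the image of [cone K] under [S p + c], with apex [a]. Covering reads
   [x + v = rho *: (S p + c + v)], whence the translation [(rho - 1) *: v]. *)
pose c := S u - v; pose a := S (stack 0 1) + c.
have inside p : cone K p -> cone L (S p + c).
  move=> Kp; have [|_ [q Lq <-] /(congr1 S)] := KT (p + u); first by exists p.
  by rewrite TS linearD /c addrA => <-; rewrite addrK.
apply: (cone_in_cone bK bL (L:=base \o S \o emb) (l:=height \o S \o emb)
  (xc:=base c) (xv:=base a) (xw:=base ((rho - 1) *: v))
  (tc:=height c) (s:=height a) (tw:=height ((rho - 1) *: v)))
  => // [k Kk||x t xt].
- rewrite -!linearD /= addrC; apply: inside.
  by rewrite /cone /= base_stack height_stack; exact: in_cone_base.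
- apply: inside; rewrite /cone /= base_stack height_stack.
  by apply: in_cone_apex; have [_ _ _ eK] := bK; exists (delta_mx 0 0).
- have [|_ [p [t01 [k Kk pE]] <-] /(congr1 S)] := TK (T (stack x t + v)).
    exists (stack x t + v) => //; exists (stack x t) => //.
    by rewrite /cone /= base_stack height_stack.
  rewrite TS (linearZ_LR S) (linearD S) => /esym xE.
  exists k, (height p).
  have pE' : p = (1 - height p) *: emb k + height p *: stack 0 1.
    rewrite -{1}(stackE p) pE embE; apply/rowP => j; rewrite !mxE.
    by case: unliftP => [i|] _; rewrite ?mxE; ring.
  have : stack x t = rho *: ((1 - height p) *: (c + S (emb k)) + height p *: a)
      + (rho - 1) *: v.
    move: xE; rewrite [in S p]pE' (linearD S) !(linearZ_LR S) => /rowP xE.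
    by apply/rowP => j; have := xE j; rewrite /a /c !mxE; lra.
  move=> h; split=> //.
    have := congr1 base h; rewrite base_stack => ->.
    by rewrite !(linearD (base (n:=2)), linearZ_LR (base (n:=2))).
  have := congr1 height h; rewrite height_stack => ->.
  by rewrite !(linearD (height (n:=2)), linearZ_LR (height (n:=2))).
Qed.

(** A ratio of the cones that fails for the planar bodies is at least 2, and 2 is already a ratio
    for these bodies. *)
Lemma dBM_cone K L : sym_body K -> sym_body L ->
  dBM (cone K) (cone L) = dBM K L.
Proof.
move=> bK bL; apply/eqP; rewrite eq_le; apply/andP; split.
  apply/ereal_infP => _ [rho KL <-]; apply: ereal_inf_lbound; exists rho => //.
  by apply: nested_cone => //; [case: KL|exact: BM_ratio_nested].
apply/ereal_infP => _ [rho KL <-]; have [rho0 _] := KL.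
have [h|h] := cone_BM_ratio bK bL KL; last first.
  by apply: ereal_inf_lbound; exists rho => //; exact: nested_BM_ratio.
apply: (@le_trans _ _ (2%:E)); last by rewrite lee_fin.
apply: ereal_inf_lbound; exists 2 => //.
by apply: nested_BM_ratio => //; exact: nested_two.
Qed.

(** The points of [K] are recombined with weights proportional to [a * (1 - t)] and [b * (1 - s)];
    if both vanish, the combination is the apex. *)
Lemma in_cone_convex K x y t s a b : convex_set K -> in_cone K x t ->
  in_cone K y s -> 0 <= a -> 0 <= b -> a + b = 1 ->
  in_cone K (a *: x + b *: y) (a * t + b * s).
Proof.
move=> /convex_setP cK [/andP[t0 t1] [z Kz ->]] [/andP[s0 s1] [w Kw ->]].
move=> a0 b0 ab.
split; first by apply/andP; split; nra.
pose c := a * (1 - t); pose d := b * (1 - s).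
have c0 : 0 <= c by rewrite mulr_ge0 // subr_ge0.
have d0 : 0 <= d by rewrite mulr_ge0 // subr_ge0.
have -> : 1 - (a * t + b * s) = c + d.
  by rewrite /c /d (_ : b = 1 - a); [ring|lra].
rewrite !scalerA -/c -/d.
have [cd|cd] := eqVneq (c + d) 0.
  have cE : c = 0 by lra.
  have dE : d = 0 by lra.
  by exists z; rewrite // cE dE add0r !scale0r addr0.
have cd0 : 0 < c + d by rewrite lt_def cd addr_ge0.
exists ((c / (c + d)) *: z + (d / (c + d)) *: w).
  by apply: cK => //; rewrite ?divr_ge0 ?addr_ge0 // -mulrDl divff.
by rewrite scalerDr !scalerA ![(c + d) * _]mulrC !divfK.
Qed.

(** Otherwise [o + U] would contain the affine span of [A], and [U] its direction space of dimension
    [d]. *)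
Lemma exists_notin_translate n d (A : set 'rV[R]_n) o (U : {vspace 'rV[R]_n}) :
  has_affine_dim d A -> (\dim U < d)%N -> exists2 x, A x & x - o \notin U.
Proof.
move=> [p [V [dV AE]]] Ud; apply: contrapT => h.
have AU : affine_span A `<=` [set x | x - o \in U].
  apply: smallest_sub.
    move=> x y t /= xU yU.
    have -> : t *: x + (1 - t) *: y - o = t *: (x - o) + (1 - t) *: (y - o).
      by apply/rowP => i; rewrite !mxE; ring.
    by rewrite memvD ?memvZ.
  move=> x Ax /=; apply: contrapT => /negP xU; apply: h; by exists x.
move: Ud; rewrite -dV ltnNge => /negP; apply; apply: dimvS; apply/subvP => w wV.
have : [set x | x - o \in U] (p + w) by apply: AU; rewrite AE; exists w.
have : [set x | x - o \in U] (p + 0).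
  by apply: AU; rewrite AE; exists 0 => //=; exact: mem0v.
move=> /= h1 h2; have := memvB h2 h1.
by rewrite opprB addrA subrK addr0 addrAC subrr add0r.
Qed.

(** * Affine normal form of the given body and its cone *)

Section Chart.
Variables (B : set 'rV[R]_3) (v : 'rV[R]_3).
Hypotheses (hB : convex_body 2 B) (sB : centrally_symmetric B)
  (hC : convex_body 3 (convex_hull (B `|` [set v]))).

(** The centre is the midpoint of any point of [B] and its reflection. *)
Lemma center_exists : exists2 o, B o & forall b, B b -> B (2 *: o - b).
Proof.
have [w wE] := sB.
have refl b : B b -> B (2 *: - w - b).
  move=> Bb; have : translate B w (- (b + w)).
    by rewrite -wE; exists (b + w) => //; exists b.
  move=> [b' Bb' /eqP]; rewrite eq_sym -subr_eq => /eqP bE.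
  suff -> : 2 *: - w - b = b' by [].
  by rewrite -bE; apply/rowP => i; rewrite !mxE; ring.
exists (- w) => //.
have [_ /convex_setP cB dB] := hB.
have dim0 : (\dim (0 : {vspace 'rV[R]_3}) < 2)%N by rewrite dimv0.
have [b Bb _] := @exists_notin_translate _ _ _ 0 0%VS dB dim0.
have := cB _ _ 2^-1 2^-1 _ _ _ Bb (refl _ Bb).
have -> : 2^-1 *: b + 2^-1 *: (2 *: - w - b) = - w.
  by apply/rowP => i; rewrite !mxE; field.
by apply; lra.
Qed.

Lemma frame_exists : exists o e0 e1, [/\ B (o + e0), B (o + e1),
  forall b, B b -> B (2 *: o - b),
  affine_span B = range (fun x => o + comb e0 e1 x) &
  injective (fun p => comb e0 e1 (base p) + height p *: (v - o))].
Proof.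
have [ o Bo oE] := center_exists.
have [[_ _ dB] [_ _ dC]] := (hB, hC).
have dim0 : (\dim (0 : {vspace 'rV[R]_3}) < 2)%N by rewrite dimv0.
have [b0 Bb0 e0N] := @exists_notin_translate _ _ _ o 0%VS dB dim0.
set e0 := b0 - o in e0N.
have d0 : \dim <[e0]> = 1%N by rewrite dim_vline -memv0 e0N.
have dim1 : (\dim <[e0]> < 2)%N by rewrite d0.
have [b1 Bb1 e1N] := @exists_notin_translate _ _ _ o <[e0]>%VS dB dim1.
set e1 := b1 - o in e1N.
pose U := (<[e0]> + <[e1]>)%VS.
have combU x : comb e0 e1 x \in U.
  by rewrite memv_add // memvZ // memv_line.
have UP w : w \in U -> exists x, w = comb e0 e1 x.
  move=> /memv_addP [_ /vlineP[a ->] [_ /vlineP[b ->] ->]].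
  exists (a *: delta_mx 0 0 + b *: delta_mx 0 1).
  by rewrite /comb !mxE /= !mulr0 !mulr1 addr0 add0r.
have [p [V [dV BE]]] := dB.
have oV w : w \in V -> affine_span B (o + w).
  have : affine_span B o by exact: sub_gen_smallest.
  by rewrite BE => -[w0 /= w0V <-] wV; exists (w0 + w); rewrite ?addrA //= memvD.
have Vo z : affine_span B z -> z - o \in V.
  have : affine_span B o by exact: sub_gen_smallest.
  rewrite BE => -[w0 /= w0V <-] [w1 /= w1V <-].
  by rewrite addrAC opprD addrA subrr add0r addrC memvB.
have UV : U = V.
  have sUV : (U <= V)%VS.
    by rewrite subv_add -!memvE !Vo //; exact: sub_gen_smallest.
  apply/eqP; rewrite eqEdim sUV dV ltnNge; apply: contra e1N => dU.
  have : (<[e0]> == U)%VS by rewrite eqEdim addvSl d0 dU.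
  by move=> /eqP ->; apply: (subvP (addvSr _ _)); exact: memv_line.
have spanE : affine_span B = range (fun x => o + comb e0 e1 x).
  apply/seteqP; split=> [x /Vo|_ [x _ <-]]; last by apply: oV; rewrite -UV.
  by rewrite -UV => /UP[y yE]; exists y; rewrite // -yE subrKC.
(* Otherwise the hull would lie in the plane [o + U], against dimension 3. *)
have e2N : v - o \notin U.
  apply/negP => vU.
  have dim2 : (\dim U < 3)%N by rewrite UV dV.
  have [x Cx /negP] := @exists_notin_translate _ _ _ o U dC dim2.
  apply; apply: (Cx [set x | x - o \in U]); split=> [|y [By|->]] //=.
    apply/convex_setP => y z a b a_ge0 b_ge0 ab /= yU zU.
    have -> : a *: y + b *: z - o = a *: (y - o) + b *: (z - o).
      by have -> : b = 1 - a by [lra]; apply/rowP => i; rewrite !mxE; ring.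
    by rewrite memvD ?memvZ.
  by rewrite UV; apply: Vo; exact: sub_gen_smallest.
(* Independence of the frame is read off down the flag [U], [<[e0]>], 0. *)
have solve (a : R) (x y : 'rV[R]_3) (W : {vspace 'rV[R]_3}) :
    a *: x + y = 0 -> y \in W -> x \notin W -> a = 0.
  move=> /eqP; rewrite addr_eq0 => /eqP axy yW; apply: contraNeq => a0.
  have : a^-1 *: (a *: x) \in W by rewrite axy; apply: memvZ; rewrite memvN.
  by rewrite scalerA mulVf // scale1r.
exists o, e0, e1; split; rewrite ?subrKC //.
move=> p' q' /eqP; rewrite -subr_eq0 => /eqP E0; apply/eqP; rewrite -subr_eq0.
set q := p' - q'; have E : height q *: (v - o) + comb e0 e1 (base q) = 0.
  by rewrite -E0; apply/rowP => i; rewrite /comb /height !mxE; ring.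
have hq := solve _ _ _ U E (combU _) e2N.
move: E; rewrite hq scale0r add0r /comb addrC => E.
have bq1 := solve _ _ _ <[e0]>%VS E (memvZ _ (memv_line _)) e1N.
move: E; rewrite bq1 scale0r add0r -[LHS]addr0 => E.
have bq0 := solve _ _ _ 0%VS E (mem0v _) e0N.
rewrite -(stackE q) hq (row2E (base q)) bq0 bq1 !scale0r addr0.
by apply/eqP/rowP => j; rewrite !mxE; case: unliftP => [i|] _; rewrite ?mxE.
Qed.

(** The frame supplies [S], which takes height 0 to the plane of [B] and the top of the axis to [v],
    after translation by [o]. One inclusion is minimality of the hull, the other its convexity. *)
Lemma cone_chart : exists (f : 'rV[R]_2 -> 'rV[R]_3)
    (S : {linear 'rV[R]_3 -> 'rV[R]_3}) (o : 'rV[R]_3),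
  [/\ affine_iso (affine_span B) f, sym_body (f @^-1` B), bijective S &
  [set p | convex_hull (B `|` [set v]) (S p + o)] = cone (f @^-1` B)].
Proof.
have [ o [e0 [e1 [Be0 Be1 oE spanE Sinj]]]] := frame_exists.
have [cptB /convex_setP cB _] := hB; have [_ /convex_setP cC _] := hC.
have Slin : linear (fun p => comb e0 e1 (base p) + height p *: (v - o)).
  by move=> a p q; apply/rowP => i; rewrite /comb /height !mxE; ring.
pose S : {linear 'rV[R]_3 -> 'rV[R]_3} := HB.pack
  (fun p => comb e0 e1 (base p) + height p *: (v - o))
  (GRing.isLinear.Build _ _ _ _ _ Slin).
have SE p : S p = comb e0 e1 (base p) + height p *: (v - o) by [].
have [M [SM MS]] := linear_inverse (S:=S) Sinj.
have combinj : injective (comb e0 e1).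
  move=> x y xy; rewrite -(base_stack x 0) -(base_stack y 0); congr base.
  by apply: Sinj; rewrite /= !base_stack !height_stack xy.
have [h hK] := linear_left_inverse combinj.
pose f (x : 'rV[R]_2) := o + comb e0 e1 x.
have bK : sym_body (f @^-1` B).
  split.
  - have -> : f @^-1` B = (fun b => h (b + - o)) @` B.
      apply/seteqP; split=> [x Bx|_ [b Bb <-]].
        by exists (f x) => //; rewrite /f addrAC subrr add0r hK.
      have : affine_span B b by exact: sub_gen_smallest.
      by rewrite spanE => -[x _ xb]; rewrite -xb /= addrAC subrr add0r hK /f xb.
    apply: continuous_compact => //; apply: continuous_subspaceT => b.
    apply: (continuous_comp (@add_cst_continuous _ _ (- o) b)).
    exact: linear_rV_continuous.
  - apply/convex_setP => x y a b a0 b0 ab /= Bx By.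
    have -> : f (a *: x + b *: y) = a *: f x + b *: f y.
      have -> : b = 1 - a by lra.
      by apply/rowP => i; rewrite /f /comb !mxE; ring.
    exact: cB.
  - move=> x /= /oE; rewrite /f linearN /=.
    by congr B; apply/rowP => i; rewrite !mxE; ring.
  - move=> i /=.
    have -> : f (delta_mx 0 i) = o + (if i == 0 then e0 else e1).
      rewrite /f /comb !mxE /=.
      by case: i => [[|[|]]] //= ?; rewrite ?scale0r ?scale1r ?addr0 ?add0r.
    by case: ifP.
exists f, S, o; split=> //.
- by exists o, (comb e0 e1 : {linear _ -> _}).
- by exists M.
apply/seteqP; split=> p.
  move=> /= Cp.
  suff : [set z | cone (f @^-1` B) (M (z - o))] (S p + o) by rewrite /= addrK SM.
  apply: Cp; split=> [|z [Bz|->]].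
  - apply/convex_setP => y z a b a0 b0 ab /= yD zD.
    have -> : M (a *: y + b *: z - o) = a *: M (y - o) + b *: M (z - o).
      rewrite -!linearZ -linearD /=; congr (M _).
      by have -> : b = 1 - a by [lra]; apply/rowP => i; rewrite !mxE; ring.
    rewrite /cone /= (linearD (base (n:=2))) (linearD (height (n:=2))).
    rewrite !(linearZ_LR (base (n:=2))) !(linearZ_LR (height (n:=2))).
    by apply: in_cone_convex => //; case: bK.
  - have : affine_span B z by exact: sub_gen_smallest.
    rewrite spanE => -[x _ xz]; rewrite -xz /= addrAC subrr add0r.
    have -> : comb e0 e1 x = S (stack x 0).
      by rewrite SE base_stack height_stack scale0r addr0.
    rewrite SM /cone /= base_stack height_stack; apply: in_cone_base.
    by rewrite /= /f xz.
  - rewrite /=; have -> : v - o = S (stack 0 1).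
      by rewrite SE base_stack height_stack linear0 add0r scale1r.
    rewrite SM /cone /= base_stack height_stack; apply: in_cone_apex.
    by case: bK => _ _ _ eK; exists (delta_mx 0 0).
move=> [/andP[t0 t1] [y By pE]] /=.
have Cgen z : (B `|` [set v]) z -> convex_hull (B `|` [set v]) z.
  exact: sub_gen_smallest.
have -> : S p + o = (1 - height p) *: f y + height p *: v.
  rewrite SE pE linearZ /= /f.
  by apply/rowP => i; rewrite !mxE; ring.
apply: cC => //; [lra|lra|by apply: Cgen; left|by apply: Cgen; right].
Qed.

End Chart.

(** * Affine invariance and the conclusion *)

Lemma dBM_affine n (K L : set 'rV[R]_n) (S S' : {linear 'rV[R]_n -> 'rV[R]_n})
    (c c' : 'rV[R]_n) : bijective S -> bijective S' ->
  dBM [set x | K (S x + c)] [set x | L (S' x + c')] = dBM K L.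
Proof.
move=> Sb S'b; rewrite /dBM; congr (ereal_inf (_ @` _)).
have [[M [SM MS]] [M' [SM' MS']]] :=
  (linear_inverse (bij_inj Sb), linear_inverse (bij_inj S'b)).
apply/seteqP; split=> rho; last exact: BM_ratio_affine.
have undo (A : set 'rV[R]_n) (F G : {linear 'rV[R]_n -> 'rV[R]_n}) a :
    cancel G F -> A = [set x | [set x | A (F x + a)] (G x + - G a)].
  by move=> GF; apply/seteqP; split=> x /=; rewrite linearD linearN !GF subrK.
rewrite {2}(undo K S M c MS) {2}(undo L S' M' c' MS').
by apply: BM_ratio_affine; [exists S|exists S'].
Qed.

End PlanarBodies.

Theorem theorem1p5 (R : realType) (B1 B2 : set 'rV[R]_3) (v1 v2 : 'rV[R]_3)
    (hB1 : convex_body 2 B1) (sB1 : centrally_symmetric B1)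
    (hB2 : convex_body 2 B2) (sB2 : centrally_symmetric B2)
    (hC1 : convex_body 3 (convex_hull (B1 `|` [set v1])))
    (hC2 : convex_body 3 (convex_hull (B2 `|` [set v2]))) :
  dBM (convex_hull (B1 `|` [set v1])) (convex_hull (B2 `|` [set v2])) =
  dBM_dim 2 B1 B2.
Proof.
have [f1 [S1 [c1 [f1E bK1 S1b C1]]]] := cone_chart hB1 sB1 hC1.
have [f2 [S2 [c2 [f2E bK2 S2b C2]]]] := cone_chart hB2 sB2 hC2.
rewrite (dBM_dimE f1E f2E) -(dBM_cone bK1 bK2) -C1 -C2.
by rewrite dBM_affine.
Qed.
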